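(* For every $p\in(1,2)$, $B\ge 1$ and $\varepsilon\in(0,1)$ there is a constant $c(B,\varepsilon,p)>0$ such that the following holds. Let $\varphi_1,\ldots,\varphi_N$ be an orthonormal system in a space $L_2(\mathcal X,\mu)$ with $\mu(\mathcal X)=1$, and suppose that $\{\varphi_k\}$ has the $S_{p'}$-property with constant $B$, i.e. $$ \Bigl\|\sum_{k=1}^N a_k\varphi_k\Bigr\|_{p'}\le B|a|\qquad\text{for all } a\in\mathbb{R}^N . $$ Then $$ d_n^{\mathrm{avg}}(\{\varphi_1,\ldots,\varphi_N\},L_p)_p\ge c(B,\varepsilon,p)\quad\text{if } n\le N(1-\varepsilon). $$
   Context: Functions are real-valued; $L_p=L_p(\mathcal X,\mu)$, $p'=p/(p-1)$, $\|\cdot\|_{p'}$ is the $L_{p'}(\mathcal X,\mu)$ norm, and $|a|$ is the Euclidean norm. The $p$-averaged Kolmogorov width of a finite system in $X=L_p$ is $d_n^{\mathrm{avg}}(\{x_1,\ldots,x_N\},X)_p:=\inf_{Q_n}\bigl(\frac1N\sum_{i=1}^N\rho(x_i,Q_n)_X^p\bigr)^{1/p}$, where $\rho(x,Q)_X=\inf_{y\in Q}\|x-y\|_X$ and the infimum is over linear subspaces $Q_n\subset X$ of dimension at most $n$. *)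

(* Defs.v *)
From HB Require Import structures.
From mathcomp Require Import all_boot all_order all_algebra.
From mathcomp Require Import all_classical all_reals all_analysis.
Set Implicit Arguments.
Unset Strict Implicit.
Unset Printing Implicit Defensive.
Import Order.TTheory GRing.Theory Num.Theory.
Import numFieldNormedType.Exports.
Local Open Scope classical_set_scope.
Local Open Scope ring_scope.

(* The norm MathComp-Analysis puts on 'rV[R]_N is the sup norm. *)
Definition euclidean_norm (R : realType) (N : nat) (a : 'rV[R]_N) : R :=
  Num.sqrt (\sum_(k < N) a 0 k ^+ 2).

(* Elements of L_p are handled through representatives f : T -> R with
   f \in Lfun mu p (f measurable, finite L_p norm); equality in L_p is equality
   mu-almost everywhere. *)

Definition orthonormal_system (d : measure_display) (T : measurableType d)
    (R : realType) (mu : {measure set T -> \bar R}) (N : nat)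
    (phi : 'I_N -> T -> R) : Prop :=
  (forall k, phi k \in Lfun mu 2%:E) /\
  (forall j k, (\int[mu]_x (phi j x * phi k x)%:E = ((j == k)%:R : R)%:E)%E).

Definition S_property (d : measure_display) (T : measurableType d)
    (R : realType) (mu : {measure set T -> \bar R}) (q B : R) (N : nat)
    (phi : 'I_N -> T -> R) : Prop :=
  forall a : 'rV[R]_N,
    ('N[mu]_(q%:E)[EFin \o (fun x => \sum_(k < N) a ord0 k * phi k x)%R]
       <= (B * euclidean_norm a)%:E)%E.

Definition Lp_subspace (d : measure_display) (T : measurableType d)
    (R : realType) (mu : {measure set T -> \bar R}) (p : R)
    (Q : {pred (T -> R)}) : Prop :=
  {subset Q <= Lfun mu p%:E} /\ submod_closed Q.

(* dim Q <= n in L_p: Q has a generating family of n (not necessarily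
   independent) elements, up to equality almost everywhere. *)
Definition Lp_dim_le (d : measure_display) (T : measurableType d)
    (R : realType) (mu : {measure set T -> \bar R}) (n : nat)
    (Q : {pred (T -> R)}) : Prop :=
  exists2 g : 'I_n -> T -> R, (forall i, g i \in Q) &
    forall f, f \in Q -> exists b : 'I_n -> R,
      f = (fun x => \sum_(i < n) b i * g i x) %[ae mu].

Definition Lp_dist (d : measure_display) (T : measurableType d)
    (R : realType) (mu : {measure set T -> \bar R}) (p : R)
    (f : T -> R) (Q : {pred (T -> R)}) : \bar R :=
  ereal_inf [set ('N[mu]_(p%:E)[EFin \o (f \- y)%R])%E | y in [set` Q]].

(* The infima are taken in \bar R, so that no boundedness side condition is
   needed; the value is finite whenever all the functions f i are in L_p. *)
Definition avg_kolmogorov_width (d : measure_display) (T : measurableType d)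
    (R : realType) (mu : {measure set T -> \bar R}) (p : R) (n N : nat)
    (f : 'I_N -> T -> R) : \bar R :=
  ereal_inf
    [set (((N%:R^-1)%:E * \sum_(i < N) (Lp_dist mu p (f i) Q `^ p)) `^ p^-1)%E
      | Q in [set Q : {pred (T -> R)} |
                Lp_subspace mu p Q /\ Lp_dim_le mu n Q]].

(* Main.v *)
Require Import Defs.
From HB Require Import structures.
From mathcomp Require Import all_boot all_order all_algebra.
From mathcomp Require Import all_classical all_reals all_analysis.
From mathcomp Require Import measurable_realfun.
Import Order.TTheory GRing.Theory Num.Theory.
Import numFieldNormedType.Exports.
Local Open Scope classical_set_scope.
Local Open Scope ring_scope.

(** A subspace Q of dimension n in L_p meets the system phi_1, ..., phi_N only
    through the n x N matrix G of the pairings <g_i, phi_j> of its generators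
    with the system; these pairings exist because the S-property puts every
    phi_j in the dual space L_q, where q = p / (p - 1).  Let P be the orthogonal
    projector of R^N onto the kernel of G ([annihilating_projector]).  Its k-th
    row a satisfies G a = 0, a_k = P_kk and |a|^2 = P_kk, so the combination
    psi = sum_j a_j phi_j annihilates Q, pairs with phi_k to a_k = P_kk by
    orthonormality, and has L_q norm at most B |a| = B sqrt(P_kk).  By duality
    the distance from phi_k to Q is at least

      <phi_k, psi> / (B sqrt(P_kk)) = sqrt(P_kk) / B

    ([sqrt_projector_diag_le_dist]).  So the diagonal of P bounds all N
    distances from below at once, and its sum is tr P >= N - n >= eps N.

    The exponent p < 2 enters when the distances are raised to the power p:
    since 0 <= P_kk <= 1, P_kk <= P_kk^(p/2) <= (B dist(phi_k, Q))^p
    ([projector_diag_le_dist]).  Averaging over k gives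
    eps <= B^p N^-1 sum_k dist(phi_k, Q)^p, hence the constant
    (eps / B^p)^(1/p) ([avg_kolmogorov_width_ge]). *)

(** * Orthogonal projectors *)

(** If v M M^T = 0 then |v M|^2 = v M M^T v^T = 0; over an ordered field this
    forces v M = 0. *)
Lemma gram_unitmx {F : realFieldType} {r N : nat} (M : 'M[F]_(r, N)) :
  row_free M -> M *m M^T \in unitmx.
Proof.
move=> Mfree; rewrite -row_free_unit; apply: inj_row_free => v vMM.
have vMvM : v *m M *m (v *m M)^T = 0.
  by rewrite trmx_mul mulmxA -(mulmxA v) vMM mul0mx.
apply: (row_free_inj Mfree); rewrite mul0mx.
apply/rowP => j; rewrite [RHS]mxE.
have := congr1 (fun A : 'M[F]_1 => A ord0 ord0) vMvM.
rewrite mxE [X in _ = X]mxE => /eqP.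
under eq_bigr do rewrite [in X in _ * X]mxE -expr2.
rewrite psumr_eq0 => [|i _]; last exact: sqr_ge0.
by move=> /allP/(_ j (mem_index_enum _)); rewrite sqrf_eq0 => /eqP.
Qed.

(** The rows of M span the vectors orthogonal to the rows of G, and
    M^T (M M^T)^-1 M is the orthogonal projector onto their span; its trace is
    the number of rows of M, by cyclicity of the trace. *)
Lemma annihilating_projector {F : realFieldType} {n N : nat} (G : 'M[F]_(n, N)) :
  exists P : 'M[F]_N,
    [/\ P^T = P, P *m P = P, G *m P = 0 & N%:R - n%:R <= \tr P].
Proof.
have [M Mfree MG] :
    exists2 M : 'M[F]_(\rank (kermx G^T), N), row_free M & M *m G^T = 0.
  exists (row_base (kermx G^T)); first exact: row_base_free.
  by apply/sub_kermxP; rewrite (eq_row_base (kermx G^T)).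
have Munit := gram_unitmx _ Mfree.
have GM : G *m M^T = 0 by apply: trmx_inj; rewrite trmx_mul trmxK MG trmx0.
exists (M^T *m invmx (M *m M^T) *m M); split.
- by rewrite !trmx_mul trmx_inv trmx_mul trmxK mulmxA.
- by rewrite !mulmxA -(mulmxA _ M M^T) mulmxKV.
- by rewrite !mulmxA GM !mul0mx.
- rewrite mxtrace_mulC mulmxA mulmxV// mxtrace1 mxrank_ker mxrank_tr.
  rewrite lerBlDr -natrD ler_nat.
  by rewrite (leq_trans _ (leq_add (leqnn _) (rank_leq_row G)))// addnC -leq_subLR.
Qed.

Section projector.
Context {F : realFieldType} {N : nat} {P : 'M[F]_N}.
Hypotheses (PT : P^T = P) (PP : P *m P = P).

Lemma projector_diagE k : P k k = \sum_j P k j ^+ 2.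
Proof.
rewrite -{1}PP mxE; apply: eq_bigr => j _.
by rewrite expr2 -{2}PT mxE.
Qed.

Lemma projector_diag_ge0 k : 0 <= P k k.
Proof. by rewrite projector_diagE sumr_ge0// => j _; exact: sqr_ge0. Qed.

(** This is Bessel's inequality for the k-th basis vector: P_kk is the squared
    norm of its projection.  It follows from P_kk^2 being one of the terms of
    P_kk = sum_j P_kj^2. *)
Lemma projector_diag_le1 k : P k k <= 1.
Proof.
have [->//|Pkk0] := eqVneq (P k k) 0.
have Pkk_gt0 : 0 < P k k by rewrite lt_def Pkk0 projector_diag_ge0.
rewrite -(ler_pM2l Pkk_gt0) mulr1 -expr2 {2}projector_diagE.
by rewrite (bigD1 k)//= lerDl sumr_ge0// => j _; exact: sqr_ge0.
Qed.

End projector.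

(** * The pairing between conjugate Lebesgue spaces *)

Section pairing.
Context {d : measure_display} {T : measurableType d} {R : realType}.
Context {mu : {measure set T -> \bar R}}.

Lemma Lfun_measurable {r : \bar R} {f : T -> R} :
  f \in Lfun mu r -> measurable_fun [set: T] f.
Proof. by rewrite inE => /andP[/[!inE]]. Qed.

Lemma Lfun_finite_norm {r : \bar R} {f : T -> R} :
  f \in Lfun mu r -> ('N[mu]_r[EFin \o f] < +oo)%E.
Proof. by rewrite inE => /andP[_ /[!inE]]. Qed.

Lemma LfunI {r : \bar R} {f : T -> R} :
  measurable_fun [set: T] f -> ('N[mu]_r[EFin \o f] < +oo)%E -> f \in Lfun mu r.
Proof. by move=> mf nf; rewrite inE; apply/andP; split; rewrite inE. Qed.

Lemma Rintegral_lincomb {n : nat} (c : 'I_n -> R) (f : 'I_n -> T -> R) :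
  (forall i, mu.-integrable [set: T] (EFin \o f i)) ->
  \int[mu]_x (\sum_(i < n) c i * f i x) = \sum_(i < n) c i * \int[mu]_x f i x.
Proof.
move=> fint; rewrite /Rintegral.
under eq_integral do rewrite -sumEFin.
under eq_integral do under eq_bigr do rewrite EFinM.
have cfint i : mu.-integrable [set: T] (fun x => ((c i)%:E * (f i x)%:E)%E).
  exact: (integrableZl measurableT (c i) (fint i)).
rewrite integral_sum// -sum_fine => [|i _]; last exact: integrable_fin_num.
apply: eq_bigr => i _; rewrite integralZl//; last exact: fint.
by rewrite fineM// integrable_fin_num//; exact: fint.
Qed.

Context {p q : R}.
Hypotheses (p0 : 0 < p) (q0 : 0 < q) (pq : p^-1 + q^-1 = 1).

Lemma Lfun_conjugate_integrable {f g : T -> R} :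
  f \in Lfun mu p%:E -> g \in Lfun mu q%:E ->
  mu.-integrable [set: T] (EFin \o (fun x => f x * g x)).
Proof.
move=> fp gq; apply/Lfun1_integrable; apply: LfunI.
  apply: measurable_funM; [exact: Lfun_measurable fp|exact: Lfun_measurable gq].
apply: le_lt_trans.
  exact: (hoelder _ (Lfun_measurable fp) (Lfun_measurable gq) p0 q0 pq).
apply: lte_mul_pinfty; [exact: Lnorm_ge0| |exact: Lfun_finite_norm gq].
rewrite ge0_fin_numE; [exact: Lfun_finite_norm fp|exact: Lnorm_ge0].
Qed.

Lemma Rintegral_hoelder {f g : T -> R} :
  f \in Lfun mu p%:E -> g \in Lfun mu q%:E ->
  ((\int[mu]_x (f x * g x))%:E
     <= 'N[mu]_(p%:E)[EFin \o f] * 'N[mu]_(q%:E)[EFin \o g])%E.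
Proof.
move=> fp gq.
apply: le_trans (hoelder _ (Lfun_measurable fp) (Lfun_measurable gq) p0 q0 pq).
have fgint := Lfun_conjugate_integrable fp gq.
rewrite Lnorm1 (le_trans _ (le_abse_integral _ _ _))//=.
  by rewrite -EFin_normr_Rintegral// lee_fin ler_norm.
by case/integrableP: fgint.
Qed.

Hypothesis p1 : (1 <= p%:E)%E.

(** The subspace is generated only up to equality almost everywhere, which the
    integral does not see. *)
Lemma generators_annihilator {n : nat} {Q : {pred (T -> R)}}
    {g : 'I_n -> T -> R} {psi : T -> R} :
  {subset Q <= Lfun mu p%:E} -> psi \in Lfun mu q%:E ->
  (forall i, g i \in Q) ->
  (forall f, f \in Q -> exists b : 'I_n -> R,
      f = (fun x => \sum_(i < n) b i * g i x) %[ae mu]) ->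
  (forall i, \int[mu]_x (g i x * psi x) = 0) ->
  forall y, y \in Q -> \int[mu]_x (y x * psi x) = 0.
Proof.
move=> Qp psiq gQ Qg gpsi y yQ.
have [b yb] := Qg y yQ.
have gint i := Lfun_conjugate_integrable (Qp _ (gQ i)) psiq.
transitivity (\int[mu]_x (\sum_(i < n) b i * (g i x * psi x))).
  congr fine; apply: ae_eq_integral => //.
  - by case/integrableP: (Lfun_conjugate_integrable (Qp _ yQ) psiq).
  - apply/measurable_EFinP; apply: measurable_sum => i.
    apply: measurable_funM => //.
    by apply/measurable_EFinP; case/integrableP: (gint i).
  - apply: filterS yb => x /= /(_ I) -> _.
    by rewrite mulr_suml; congr EFin; apply: eq_bigr => i _; rewrite mulrA.
by rewrite Rintegral_lincomb// big1// => i _; rewrite gpsi mulr0.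
Qed.

(** The easy half of the duality between distances and annihilators:
    for y in Q, <f, psi> = <f - y, psi> is at most the product of the norms of
    f - y and psi. *)
Lemma Lp_dist_annihilator {Q : {pred (T -> R)}} {f psi : T -> R} {M : R} :
  {subset Q <= Lfun mu p%:E} -> f \in Lfun mu p%:E -> psi \in Lfun mu q%:E ->
  (forall y, y \in Q -> \int[mu]_x (y x * psi x) = 0) ->
  0 < M -> ('N[mu]_(q%:E)[EFin \o psi] <= M%:E)%E ->
  ((\int[mu]_x (f x * psi x) / M)%:E <= Lp_dist mu p f Q)%E.
Proof.
move=> Qp fp psiq Qpsi M0 psiM; apply/ereal_infP => _ /= [y yQ <-].
have yp := Qp _ yQ.
have fyp : (f \- y)%R \in Lfun mu p%:E.
  by have [_] := GRing.submod_closedB (Lfun_submod_closed mu p1); apply.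
rewrite EFinM lee_pdivrMr//.
apply: le_trans (lee_wpmul2l (Lnorm_ge0 _ _ _) psiM).
apply: le_trans (Rintegral_hoelder fyp psiq).
rewrite lee_fin le_eqVlt; apply/orP; left; apply/eqP.
under [RHS]eq_Rintegral do rewrite mulrBl.
rewrite (RintegralB measurableT (Lfun_conjugate_integrable fp psiq)
  (Lfun_conjugate_integrable yp psiq)).
by rewrite (Qpsi y yQ) subr0.
Qed.

End pairing.

(** * Distances from the system to a subspace *)

Lemma euclidean_norm_row {R : realType} {N : nat} {P : 'M[R]_N} k :
  P^T = P -> P *m P = P -> euclidean_norm (row k P) = Num.sqrt (P k k).
Proof.
move=> PT PP; rewrite /euclidean_norm projector_diagE//; congr Num.sqrt.
by apply: eq_bigr => j _; rewrite mxE.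
Qed.

Section width.
Context {R : realType} {p B : R}.
Hypotheses (p1 : 1 < p) (p2 : p < 2) (B0 : 0 < B).
Context {d : measure_display} {T : measurableType d} {mu : probability T R}.
Context {N : nat} {phi : 'I_N -> T -> R}.
Hypotheses (phi_on : orthonormal_system mu phi)
  (phi_S : S_property mu (p / (p - 1)) B phi).

Let q := p / (p - 1).
Let p0 : 0 < p. Proof. exact: lt_trans p1. Qed.
Let q0 : 0 < q. Proof. by rewrite divr_gt0// subr_gt0. Qed.
Let pq : p^-1 + q^-1 = 1.
Proof. by rewrite /q invf_div -{1}[p^-1]mul1r -mulrDl subrKC divff// gt_eqF. Qed.

Lemma S_property_Lfun (a : 'rV[R]_N) :
  (fun x => \sum_(k < N) a ord0 k * phi k x) \in Lfun mu q%:E.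
Proof.
apply: LfunI; last by rewrite (le_lt_trans (phi_S a))// ltry.
apply: measurable_sum => k; apply: measurable_funM => //.
exact: Lfun_measurable (phi_on.1 k).
Qed.

(** The S-property applied to a unit coordinate vector: the phi_k themselves lie
    in the dual space, so that they can be paired with every element of L_p. *)
Lemma S_property_term_Lfun k : phi k \in Lfun mu q%:E.
Proof.
rewrite (_ : phi k =
    fun x => \sum_(j < N) (delta_mx 0 k : 'rV[R]_N) ord0 j * phi j x).
  exact: S_property_Lfun.
apply/funext => x; rewrite (bigD1 k)//= big1 => [|j jk].
  by rewrite mxE !eqxx mul1r addr0.
by rewrite mxE (negbTE jk) mul0r.
Qed.

(** On a probability space L_2 is contained in L_p for p <= 2. *)
Lemma orthonormal_Lfun k : phi k \in Lfun mu p%:E.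
Proof.
apply: (@Lfun_subset _ _ _ mu p%:E 2%:E) (phi_on.1 k).
- by rewrite lee_fin ltW.
- by rewrite lee_fin ler1n.
- exact: fin_num_measure.
- by rewrite lee_fin ltW.
Qed.

Lemma pairing_lincomb {f : T -> R} (a : 'rV[R]_N) : f \in Lfun mu p%:E ->
  \int[mu]_x (f x * \sum_(k < N) a ord0 k * phi k x) =
  \sum_(k < N) a ord0 k * \int[mu]_x (f x * phi k x).
Proof.
move=> fp; rewrite -Rintegral_lincomb => [|k].
  apply: eq_Rintegral => x _; rewrite mulr_sumr.
  by apply: eq_bigr => k _; rewrite mulrCA.
exact: (Lfun_conjugate_integrable p0 q0 pq fp (S_property_term_Lfun k)).
Qed.

Lemma pairing_phi j k : \int[mu]_x (phi j x * phi k x) = (j == k)%:R.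
Proof. by rewrite /Rintegral phi_on.2. Qed.

Section subspace.
Context {n : nat} {Q : {pred (T -> R)}} {g : 'I_n -> T -> R} {P : 'M[R]_N}.
Hypotheses (Qp : {subset Q <= Lfun mu p%:E}) (gQ : forall i, g i \in Q)
  (Qg : forall f, f \in Q -> exists b : 'I_n -> R,
      f = (fun x => \sum_(i < n) b i * g i x) %[ae mu])
  (PT : P^T = P) (PP : P *m P = P)
  (GP : (\matrix_(i, j) \int[mu]_x (g i x * phi j x)) *m P = 0).

(** The k-th row of P gives the coefficients of a functional psi that vanishes
    on Q, because G P = 0, while its value at phi_k is P_kk and its norm is at
    most B sqrt(P_kk). *)
Lemma sqrt_projector_diag_le_dist k :
  ((Num.sqrt (P k k) / B)%:E <= Lp_dist mu p (phi k) Q)%E.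
Proof.
(* If P_kk = 0 then psi vanishes and only positivity of the distance remains. *)
have [Pkk0|Pkk0] := eqVneq (P k k) 0.
  rewrite Pkk0 sqrtr0 mul0r; apply/ereal_infP => _ [y _ <-].
  exact: Lnorm_ge0.
have Pkk_gt0 : 0 < P k k by rewrite lt_def Pkk0 projector_diag_ge0.
pose a := row k P; pose psi x := \sum_(j < N) a ord0 j * phi j x.
have psiq : psi \in Lfun mu q%:E := S_property_Lfun a.
have phipsi : \int[mu]_x (phi k x * psi x) = P k k.
  rewrite pairing_lincomb; last exact: orthonormal_Lfun.
  rewrite (bigD1 k)//= big1 => [|j jk].
    by rewrite pairing_phi eqxx mulr1 addr0 mxE.
  by rewrite pairing_phi eq_sym (negbTE jk) mulr0.
have Qpsi : forall y, y \in Q -> \int[mu]_x (y x * psi x) = 0.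
  apply: (generators_annihilator p0 q0 pq Qp psiq gQ Qg) => i.
  rewrite pairing_lincomb; last exact: Qp.
  have /matrixP/(_ i k) := GP; rewrite mxE [X in _ = X]mxE => GPik.
  rewrite -[RHS]GPik.
  apply: eq_bigr => j _.
  by rewrite [in RHS]mxE mulrC [in LHS]mxE -[in LHS]PT mxE.
have sqrtP_gt0 : 0 < Num.sqrt (P k k) by rewrite sqrtr_gt0.
have -> : Num.sqrt (P k k) / B =
    (\int[mu]_x (phi k x * psi x)) / (B * Num.sqrt (P k k)).
  have sqrtP_neq0 : Num.sqrt (P k k) != 0 by rewrite gt_eqF.
  rewrite phipsi mulrC invfM mulrCA; congr (_ * _).
  by apply: (mulIf sqrtP_neq0); rewrite divfK// -expr2 sqr_sqrtr// ltW.
apply: (Lp_dist_annihilator p0 q0 pq _ Qp (orthonormal_Lfun k) psiq Qpsi).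
- by rewrite lee_fin ltW.
- exact: mulr_gt0.
- by rewrite -(euclidean_norm_row k PT PP); exact: phi_S.
Qed.

(** Raising the bound on the distance to the power p gives P_kk^(p/2) / B^p,
    and t <= t^(p/2) for 0 <= t <= 1 because p/2 <= 1.  The result is linear in
    P_kk, so that summing over k yields the trace of P. *)
Lemma projector_diag_le_dist k :
  ((P k k / B `^ p)%:E <= Lp_dist mu p (phi k) Q `^ p)%E.
Proof.
have [Pkk0|Pkk0] := eqVneq (P k k) 0.
  by rewrite Pkk0 mul0r poweR_ge0.
have Pkk_ge0 : 0 <= P k k by rewrite projector_diag_ge0.
have dist_ge := sqrt_projector_diag_le_dist k.
have root_ge0 : 0 <= Num.sqrt (P k k) / B by rewrite divr_ge0// ltW.
apply: (@le_trans _ _ ((Num.sqrt (P k k) / B)%:E `^ p)%E); last first.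
  apply: gt0_ler_poweR => //; first exact: ltW.
  - by rewrite in_itv/= lee_fin root_ge0 leey.
  - by rewrite in_itv/= leey andbT (le_trans _ dist_ge).
rewrite poweR_EFin lee_fin powRM ?sqrtr_ge0 ?invr_ge0 ?(ltW B0)//.
rewrite -(powR_inv1 (ltW B0)) powRAC (powR_inv1 (powR_ge0 _ _)).
rewrite ler_pM2r ?invr_gt0 ?powR_gt0// -powR12_sqrt// -powRrM.
apply: ger1_powR; first by rewrite lt_def Pkk0 Pkk_ge0 projector_diag_le1.
by rewrite ler_pdivrMl// mulr1 ltW.
Qed.

End subspace.

(** Summing the diagonal bounds turns the trace estimate tr P >= N - n >= eps N
    into a lower bound for the average of the p-th powers of the distances. *)
Lemma avg_kolmogorov_width_ge {eps : R} {n : nat} :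
  0 < eps -> (0 < N)%N -> n%:R <= N%:R * (1 - eps) ->
  (((eps / B `^ p) `^ p^-1)%:E <= avg_kolmogorov_width mu p n phi)%E.
Proof.
move=> eps0 N0 nN; apply/ereal_infP => _ /= [Q [[Qp _] [g gQ Qg]] <-].
have [P [PT PP GP trP]] :=
  annihilating_projector (\matrix_(i, j) \int[mu]_x (g i x * phi j x)).
have N0' : 0 < N%:R :> R by rewrite ltr0n.
rewrite -poweR_EFin; apply: gt0_ler_poweR.
- by rewrite invr_ge0 ltW.
- by rewrite in_itv/= leey lee_fin divr_ge0 ?powR_ge0// ltW.
- rewrite in_itv/= leey andbT mule_ge0// ?lee_fin ?invr_ge0//.
  by apply: sume_ge0 => k _; exact: poweR_ge0.
- apply: (@le_trans _ _ ((N%:R^-1)%:E * \sum_(k < N) (P k k / B `^ p)%:E)%E).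
    rewrite sumEFin -EFinM lee_fin -mulr_suml mulrA.
    rewrite ler_pM2r ?invr_gt0 ?powR_gt0// ler_pdivlMl//.
    by apply: le_trans trP; move: nN; rewrite mulrBr mulr1 lerBrDr lerBrDl.
  rewrite lee_wpmul2l ?lee_fin ?invr_ge0//.
  apply: lee_sum => k _; exact: (projector_diag_le_dist Qp gQ Qg).
Qed.

End width.

Theorem theorem1p3 (R : realType) (p B eps : R) :
  1 < p -> p < 2 -> 1 <= B -> 0 < eps -> eps < 1 ->
  exists2 c : R, 0 < c &
    forall (d : measure_display) (T : measurableType d)
      (mu : probability T R) (N : nat) (phi : 'I_N -> T -> R),
      (0 < N)%N ->
      orthonormal_system mu phi ->
      S_property mu (p / (p - 1)) B phi ->
      forall n : nat, n%:R <= N%:R * (1 - eps) ->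
      (c%:E <= avg_kolmogorov_width mu p n phi)%E.
Proof.
move=> p1 p2 B1 eps0 _; have B0 : 0 < B := lt_le_trans ltr01 B1.
exists ((eps / B `^ p) `^ p^-1); first by rewrite powR_gt0// divr_gt0// powR_gt0.
move=> d T mu N phi N0 phi_on phi_S n nN.
exact: (avg_kolmogorov_width_ge p1 p2 B0 phi_on phi_S eps0 N0 nN).
Qed.
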